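(* For every quiver $G$, the quivers $G$ and $\bar{\mathcal{R}}(G)$ (the reduced digraph of $G$) are strong homotopy equivalent.
   Context: A quiver $G=(V_G,E_G,s_G,t_G)$ consists of a non-empty set $V_G$ of vertices, a set $E_G$ of edges and functions $s_G,t_G\colon E_G\to V_G$. A quiver map $m\colon G\to G'$ is a pair $m_V\colon V_G\to V_{G'}$, $m_E\colon E_G\to E_{G'}\sqcup V_{G'}$ such that each edge $e$ is sent either to an edge with source $m_V(s(e))$ and target $m_V(t(e))$, or to the vertex $m_V(s(e))=m_V(t(e))$. Composition is the evident one (if an edge is sent to a vertex, the next vertex function is applied to it). The reduced digraph $\bar{\mathcal{R}}(G)$ has vertex set $V_G$ and exactly one edge $\bar{\mathcal{R}}(G,u,v)$, from $u$ to $v$, for each ordered pair of distinct vertices $u\ne v$ such that there exists $e\in E_G$ with $s(e)=u$, $t(e)=v$ (and no other edges). $I$ is the quiver with vertices $0,1$ and a single edge $0\to1$. The strong box product $G\boxtimes I$ has vertices $V_G\times\{0,1\}$ and edges: $(e,k)$ from $(s(e),k)$ to $(t(e),k)$ for $e\in E_G$, $k\in\{0,1\}$; $(v,0\to1)$ from $(v,0)$ to $(v,1)$ for $v\in V_G$; and $(e,0\to1)$ from $(s(e),0)$ to $(t(e),1)$ for $e\in E_G$. For $k=0,1$ let $i_k\colon G\to G\boxtimes I$ be $v\mapsto(v,k)$, $e\mapsto(e,k)$. Quiver maps $f_0,f_1\colon G\to H$ are $1$-step strong homotopic if there is a quiver map $F\colon G\boxtimes I\to H$ with $F\circ i_0=f_0$,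 $F\circ i_1=f_1$; the relation $\simeq^S$ is the equivalence relation generated by this. Quivers $G,G'$ are strong homotopy equivalent if there are quiver maps $f\colon G\to G'$, $h\colon G'\to G$ with $h\circ f\simeq^S\mathrm{id}_G$ and $f\circ h\simeq^S\mathrm{id}_{G'}$. The axiom of choice may be used. *)

(* Defs.v *)
From Stdlib Require Import Relations.

Set Implicit Arguments.
Unset Strict Implicit.

Record quiver : Type := Quiver {
  vertex : Type;
  edge : Type;
  source : edge -> vertex;
  target : edge -> vertex;
  vertex_nonempty : inhabited vertex
}.

Arguments source {q} _.
Arguments target {q} _.

(* An edge goes to [inl] of an edge or is collapsed to [inr] of a vertex.
   The condition is a [Prop], so, by proof irrelevance and functional
   extensionality, equality of quiver maps is equality of their two
   underlying functions. *)
Record quiver_map (G H : quiver) : Type := QuiverMap {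
  vmap : vertex G -> vertex H;
  emap : edge G -> edge H + vertex H;
  emap_compat : forall e : edge G,
    match emap e with
    | inl e' => source e' = vmap (source e) /\ target e' = vmap (target e)
    | inr v => v = vmap (source e) /\ v = vmap (target e)
    end
}.

Definition id_map (G : quiver) : quiver_map G G.
Proof.
refine {| vmap := fun v => v; emap := fun e => inl e |}.
split; reflexivity.
Defined.

Definition comp_map (G H K : quiver) (g : quiver_map H K) (f : quiver_map G H) :
  quiver_map G K.
Proof.
refine {| vmap := fun v => vmap g (vmap f v);
          emap := fun e => match emap f e with
                           | inl e' => emap g e'
                           | inr v => inr (vmap g v)
                           end |}.
intro e; generalize (emap_compat f e).
destruct (emap f e) as [e' | v]; intros [Hs Ht].
- rewrite <- Hs, <- Ht; apply emap_compat.
- rewrite <- Hs, <- Ht; split; reflexivity.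
Defined.

Definition reduced_digraph (G : quiver) : quiver := {|
  vertex := vertex G;
  edge := {p : vertex G * vertex G |
             fst p <> snd p /\
             exists e : edge G, source e = fst p /\ target e = snd p};
  source := fun p => fst (proj1_sig p);
  target := fun p => snd (proj1_sig p);
  vertex_nonempty := vertex_nonempty G
|}.

(* [false] and [true] are the vertices 0 and 1, [tt] is the edge 0 -> 1. *)
Definition interval : quiver := {|
  vertex := bool;
  edge := unit;
  source := fun _ => false;
  target := fun _ => true;
  vertex_nonempty := inhabits false
|}.

Inductive box_edge (G H : quiver) : Type :=
| EdgeVertex (e : edge G) (w : vertex H)
| VertexEdge (v : vertex G) (f : edge H)
| EdgeEdge (e : edge G) (f : edge H).

Definition strong_box (G H : quiver) : quiver := {|
  vertex := vertex G * vertex H;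
  edge := box_edge G H;
  source := fun a => match a with
                     | EdgeVertex e w => (source e, w)
                     | VertexEdge v f => (v, source f)
                     | EdgeEdge e f => (source e, source f)
                     end;
  target := fun a => match a with
                     | EdgeVertex e w => (target e, w)
                     | VertexEdge v f => (v, target f)
                     | EdgeEdge e f => (target e, target f)
                     end;
  vertex_nonempty := match vertex_nonempty G, vertex_nonempty H with
                     | inhabits v, inhabits w => inhabits (v, w)
                     end
|}.

Definition box_incl (G : quiver) (k : vertex interval) :
  quiver_map G (strong_box G interval).
Proof.
refine {| vmap := fun v => (v, k) : vertex (strong_box G interval);
          emap := fun e => inl (EdgeVertex e k : edge (strong_box G interval)) |}.
split; reflexivity.
Defined.

Definition one_step_strong_homotopic (G H : quiver) : relation (quiver_map G H) :=
  fun f0 f1 => exists F : quiver_map (strong_box G interval) H,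
    comp_map F (box_incl G false) = f0 /\ comp_map F (box_incl G true) = f1.

Definition strong_homotopic (G H : quiver) : relation (quiver_map G H) :=
  clos_refl_sym_trans (quiver_map G H) (@one_step_strong_homotopic G H).

Definition strong_homotopy_equivalent (G H : quiver) : Prop :=
  exists (f : quiver_map G H) (h : quiver_map H G),
    strong_homotopic (comp_map h f) (id_map G) /\
    strong_homotopic (comp_map f h) (id_map H).

(* Main.v *)
From Stdlib Require Import Relations ClassicalEpsilon ProofIrrelevance.
Require Import Defs.

(** Two quiver maps with the same vertex function are one-step strong homotopic,
    because every edge of [G x I] lies over a pair of vertices whose images do not
    depend on the interval coordinate. Both the projection [G -> R(G)] and a
    section [R(G) -> G] choosing an edge between each pair of adjacent vertices
    are the identity on vertices, hence so are their two composites. *)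

Lemma quiver_map_ext (G H : quiver) (f g : quiver_map G H) :
  vmap f = vmap g -> emap f = emap g -> f = g.
Proof.
destruct f as [fv fe cf], g as [gv ge cg]; simpl; intros <- <-.
f_equal; apply proof_irrelevance.
Qed.

Section SameVertexMap.

Variables (G H : quiver) (f g : quiver_map G H).
Hypothesis vmap_eq : forall v : vertex G, vmap f v = vmap g v.

(* The diagonal edge [(e, 0 -> 1)] may be sent to either [f e] or [g e]. *)
Definition same_vmap_homotopy : quiver_map (strong_box G interval) H.
Proof.
refine (@QuiverMap (strong_box G interval) H
  (fun x => if snd x then vmap g (fst x) else vmap f (fst x))
  (fun a => match a with
            | EdgeVertex e k => if k then emap g e else emap f e
            | VertexEdge v _ => inr (vmap f v)
            | EdgeEdge e _ => emap g e
            end) _).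
intros [e [|] | v [] | e []]; simpl.
- apply (emap_compat g e).
- apply (emap_compat f e).
- split; [reflexivity | apply vmap_eq].
(* The diagonal starts at level 0, where the homotopy acts by [vmap f], while compatibility of
   [emap g e] is about [vmap g]. *)
- rewrite vmap_eq; apply (emap_compat g e).
Defined.

Lemma same_vmap_one_step_strong_homotopic : one_step_strong_homotopic f g.
Proof.
exists same_vmap_homotopy; split; apply quiver_map_ext; reflexivity.
Qed.

End SameVertexMap.

(** The reduced digraph has no loops, so loops collapse to their vertex; classical logic decides
    which edges are loops. *)
Definition to_reduced (G : quiver) : quiver_map G (reduced_digraph G).
Proof.
refine (@QuiverMap G (reduced_digraph G) (fun v => v)
  (fun e => match excluded_middle_informative (source e = target e) with
            | left _ => inr (source e)
            | right ne => inl (exist _ (source e, target e)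
                (conj ne (ex_intro _ e (conj eq_refl eq_refl))))
            end) _).
intro e; destruct (excluded_middle_informative (source e = target e));
  split; trivial.
Defined.

Definition from_reduced (G : quiver) : quiver_map (reduced_digraph G) G.
Proof.
refine (@QuiverMap (reduced_digraph G) G (fun v => v)
  (fun p => inl (proj1_sig (constructive_indefinite_description _
                              (proj2 (proj2_sig p))))) _).
(* The property by which the edge was chosen is exactly the required compatibility. *)
intro p; apply proj2_sig.
Defined.

Theorem proposition5p1 (G : quiver) :
  strong_homotopy_equivalent G (reduced_digraph G).
Proof.
exists (to_reduced G), (from_reduced G).
split; apply rst_step, same_vmap_one_step_strong_homotopic; reflexivity.
Qed.
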